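(* Let $T_{\boldsymbol\theta}$ be a dynamical system with ACIM given by $\lambda_T$, and let $\{\boldsymbol{x}_t\}_{t\ge1}$ be a set of random covariates. Suppose $\{Y_t\}_{t\ge1}$ is a $\beta$ARC model (as defined in the context) with $\nu>0$ where $$\eta_t=g(\mu_t)=\alpha+\boldsymbol{x}_t'\boldsymbol\beta+h\big(T_{\boldsymbol\theta}^{t-1}(U_0)\big),$$ for two twice continuously differentiable, one-to-one link functions $g$ and $h$. Suppose $U_0$ is chosen according to $\lambda_T$. Then, if $\{\boldsymbol{x}_t\}_{t\ge1}$ is stationary, so is $\{Y_t\}_{t\ge1}$.
   Context: $T_{\boldsymbol\theta}:[0,1]\to[0,1]$ is a Borel measurable map, potentially depending on an $r$-dimensional vector of parameters $\boldsymbol\theta\in\mathbb{R}^r$, and $T_{\boldsymbol\theta}^{k}$ denotes its $k$-th iterate ($k$-fold composition). An ACIM for $T_{\boldsymbol\theta}$ is a probability measure $\lambda_T$ on the Borel sets of $[0,1]$ which is invariant, i.e. $\lambda_T\big(T_{\boldsymbol\theta}^{-1}(A)\big)=\lambda_T(A)$ for all measurable $A\subset[0,1]$, and absolutely continuous with respect to Lebesgue measure. The $\beta$ARC model (here without autoregressive terms): $\{\boldsymbol{x}_t\}_{t\ge1}$ are $l$-dimensional exogenous time dependent covariates, $U_0$ is a random variable taking values in $(0,1)$, and $\mathscr{F}_t$ is the $\sigma$-field generated by $(U_0,\boldsymbol{x}_t',\dots,\boldsymbol{x}_1',Y_t,\dots,Y_1)$, representing the observed history of the model up to time $t$. Conditionally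 on $\mathscr{F}_{t-1}$, $Y_t$ has the beta density $$f(y;\mu_t,\nu\mid\mathscr{F}_{t-1})=\frac{\Gamma(\nu)}{\Gamma(\nu\mu_t)\Gamma\big(\nu(1-\mu_t)\big)}\,y^{\nu\mu_t-1}(1-y)^{\nu(1-\mu_t)-1},$$ for $0<y<1$, $0<\mu_t<1$ and $\nu>0$, where $\mu_t:=\mathbb{E}(Y_t\mid\mathscr{F}_{t-1})$ is specified through the displayed equation for $g(\mu_t)$ in the claim, with $g,h:(0,1)\to\mathbb{R}$, intercept $\alpha\in\mathbb{R}$ and $l$-dimensional parameter $\boldsymbol\beta=(\beta_1,\dots,\beta_l)'$. Stationary means that all finite-dimensional distributions are invariant under time shifts.
   Formalization: Exogenous is made precise: the covariates are independent of U_0, and Y_t is conditionally independent of the whole covariate path given the information at time t; conditioning is on F_{t-1} together with x_t. Without such conditions the claim can fail. *)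

(* Defs.v *)
From HB Require Import structures.
From mathcomp Require Import all_boot all_order all_algebra.
From mathcomp Require Import all_classical all_reals all_analysis measurable_realfun.

Set Implicit Arguments.
Unset Strict Implicit.
Unset Printing Implicit Defensive.

Import Order.TTheory GRing.Theory Num.Theory.
Import numFieldNormedType.Exports.

Local Open Scope classical_set_scope.
Local Open Scope ring_scope.

(* Maps of [0, 1] and functions on (0, 1) are total functions R -> R whose
   values outside the interval are never used. *)

Definition interval_map (R : realType) (T : R -> R) : Prop :=
  measurable_fun (`[0, 1] : set R) T /\
  (forall u : R, u \in `[0, 1] -> T u \in `[0, 1]).

(* A probability measure on the Borel sets of [0, 1] is a Borel probability
   measure on R that is concentrated on [0, 1]. *)
Record is_acim (R : realType) (T : R -> R)
    (lam : probability (measurableTypeR R) R) : Prop := IsACIM {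
  acim_support : lam [set` `[0, 1]] = 1%E;
  acim_invariant : forall A : set (measurableTypeR R),
    measurable A -> A `<=` [set` `[0, 1]] ->
    lam ([set` `[0, 1]] `&` T @^-1` A) = lam A;
  acim_abs_continuous : lam `<< (@lebesgue_measure R)
}.

Record link_function (R : realType) (f : R -> R) : Prop := LinkFunction {
  link_derivable : forall u : R, u \in `]0, 1[ -> derivable f u 1;
  link_derivable2 : forall u : R, u \in `]0, 1[ -> derivable (derive1 f) u 1;
  link_continuous2 : forall u : R, u \in `]0, 1[ ->
    {for u, continuous (derive1 (derive1 f))};
  link_injective : {in `]0, 1[ &, injective f}
}.

Definition Gamma (R : realType) (a : R) : R :=
  \int[lebesgue_measure]_(s in `]0, +oo[) (s `^ (a - 1) * expR (- s)).

Definition beta_density (R : realType) (nu m y : R) : R :=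
  if y \in `]0, 1[ then
    Gamma nu / (Gamma (nu * m) * Gamma (nu * (1 - m)))
      * y `^ (nu * m - 1) * (1 - y) `^ (nu * (1 - m) - 1)
  else 0.

(* Z is a version of E(X | G), for a sub-sigma-algebra G. *)
Record is_cond_exp (d : measure_display) (Omega : measurableType d)
    (R : realType) (P : probability Omega R) (G : set (set Omega))
    (X Z : Omega -> \bar R) : Prop := IsCondExp {
  cond_exp_measurable : forall B : set (\bar R), measurable B -> G (Z @^-1` B);
  cond_exp_integrable : P.-integrable setT Z;
  cond_expE : forall A, G A ->
    (\int[P]_(w in A) Z w = \int[P]_(w in A) X w)%E
}.

(* Z is a version of P(A | G). *)
Definition is_cond_prob (d : measure_display) (Omega : measurableType d)
    (R : realType) (P : probability Omega R) (G : set (set Omega))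
    (A : set Omega) (Z : Omega -> \bar R) : Prop :=
  is_cond_exp P G (fun w => (\1_A w)%:E) Z.

(* Processes are indexed by t >= 1; index 0 is never used. *)

Definition stationary (d d' : measure_display) (Omega : measurableType d)
    (S : measurableType d') (R : realType) (P : probability Omega R)
    (X : nat -> {RV P >-> S}) : Prop :=
  forall (n : nat) (t : 'I_n -> nat) (k : nat) (A : set (n.-tuple S)),
    (forall i, (1 <= t i)%N) -> measurable A ->
    P [set w | A [tuple X (t i + k)%N w | i < n]] =
    P [set w | A [tuple X (t i) w | i < n]].

Definition covariate_sigma (d d' : measure_display) (Omega : measurableType d)
    (S : measurableType d') (R : realType) (P : probability Omega R)
    (x : nat -> {RV P >-> S}) : set (set Omega) :=
  <<s \bigcup_(s in [set s | (1 <= s)%N]) g_sigma_algebra_preimage (x s) >>.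

(* F_t = sigma(U_0, x_t, ..., x_1, Y_t, ..., Y_1) *)
Definition history (d d' : measure_display) (Omega : measurableType d)
    (S : measurableType d') (R : realType) (P : probability Omega R)
    (U0 : {RV P >-> R}) (x : nat -> {RV P >-> S}) (Y : nat -> {RV P >-> R})
    (t : nat) : set (set Omega) :=
  <<s g_sigma_algebra_preimage U0 `|`
      \bigcup_(s in [set s | (1 <= s <= t)%N])
        (g_sigma_algebra_preimage (x s) `|` g_sigma_algebra_preimage (Y s)) >>.

(* The conditioning sigma-algebra for Y_t: the observed history F_{t-1}
   together with x_t. The latter enters the equation for g(mu_t), so it has to
   be known for mu_t to be a conditional mean. *)
Definition information (d d' : measure_display) (Omega : measurableType d)
    (S : measurableType d') (R : realType) (P : probability Omega R)
    (U0 : {RV P >-> R}) (x : nat -> {RV P >-> S}) (Y : nat -> {RV P >-> R})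
    (t : nat) : set (set Omega) :=
  <<s history U0 x Y t.-1 `|` g_sigma_algebra_preimage (x t) >>.

(* Strict exogeneity of the covariates: they are independent of the initial
   state U_0, and there is no feedback from the response, i.e. further knowledge
   of the whole covariate path does not change the conditional law of Y_t.
   The last condition is conditional independence of Y_t and (x_s)_{s >= 1}
   given the information at time t. *)
Record exogenous (d d' : measure_display) (Omega : measurableType d)
    (S : measurableType d') (R : realType) (P : probability Omega R)
    (U0 : {RV P >-> R}) (x : nat -> {RV P >-> S}) (Y : nat -> {RV P >-> R})
    : Prop := Exogenous {
  exogenous_initial : forall (B : set R) (C : set Omega),
    measurable B -> covariate_sigma x C ->
    P (U0 @^-1` B `&` C) = (P (U0 @^-1` B) * P C)%E;
  exogenous_response : forall (t : nat) (B : set R) (Z : Omega -> \bar R),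
    (1 <= t)%N -> measurable B ->
    is_cond_prob P (information U0 x Y t) (Y t @^-1` B) Z ->
    is_cond_prob P <<s information U0 x Y t `|` covariate_sigma x >>
      (Y t @^-1` B) Z
}.

(* The betaARC model without autoregressive terms. The equation for g(mu_t) is
   almost sure, because T^(t-1)(U_0) may hit the endpoints of [0, 1], where h
   is not defined; this event is null when U_0 follows an ACIM. *)
Record betaARC (d : measure_display) (Omega : measurableType d) (R : realType)
    (P : probability Omega R) (l : nat) (T : R -> R) (U0 : {RV P >-> R})
    (x : nat -> {RV P >-> l.-tuple R}) (Y : nat -> {RV P >-> R})
    (mu : nat -> Omega -> R) (nu : R) (g h : R -> R) (alpha : R)
    (beta : l.-tuple R) : Prop := BetaARC {
  betaARC_initial : forall w, U0 w \in `]0, 1[;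
  betaARC_exogenous : exogenous U0 x Y;
  betaARC_mu01 : forall t w, (1 <= t)%N -> mu t w \in `]0, 1[;
  betaARC_mean : forall t, (1 <= t)%N ->
    is_cond_exp P (information U0 x Y t)
      (fun w => (Y t w)%:E) (fun w => (mu t w)%:E);
  betaARC_density : forall (t : nat) (B : set R), (1 <= t)%N -> measurable B ->
    is_cond_prob P (information U0 x Y t) (Y t @^-1` B)
      (fun w => \int[lebesgue_measure]_(y in B)
                  (beta_density nu (mu t w) y)%:E)%E;
  betaARC_link : forall t, (1 <= t)%N ->
    {ae P, forall w, g (mu t w) =
      alpha + \sum_(j < l) tnth (x t w) j * tnth beta j
      + h (iter t.-1 T (U0 w))}
}.

(* Main.v *)
(* Write G for the inverse of g on (0, 1), p(m, B) for the beta probability of B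
   with mean m, and V = T^k(U_0). Almost surely
   mu_(k+i) = G(alpha + x_(k+i)'beta + h(T^(i-1)(V))) is a function of the
   covariates and U_0, so the tower property, used from the last time backwards
   together with strict exogeneity, gives
   P(Y_(k+1) in B_1, .., Y_(k+n) in B_n) = E[prod_i p(mu_(k+i), B_i)].
   The right-hand side only depends on the joint law of
   ((x_(k+1), .., x_(k+n)), V), which is the product of the law of the block of
   covariates and lambda_T by independence, and hence does not depend on k, by
   stationarity of the covariates and invariance of lambda_T. *)
Require Import Defs.
From HB Require Import structures.
From mathcomp Require Import all_boot all_order all_algebra.
From mathcomp Require Import all_classical all_reals all_analysis measurable_realfun.
Import Order.TTheory GRing.Theory Num.Theory.
Import numFieldNormedType.Exports.
Local Open Scope classical_set_scope.
Local Open Scope ring_scope.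

Set Implicit Arguments.
Unset Strict Implicit.
Unset Printing Implicit Defensive.

(** * Integrals with a weight that factors through a measurable map *)

Section weighted_integral.
Local Open Scope ereal_scope.
Context (d1 d2 : measure_display) (T1 : measurableType d1)
  (T2 : measurableType d2) (R : realType).
Variables (m : {measure set T1 -> \bar R}) (phi : T1 -> T2).
Hypothesis mphi : measurable_fun setT phi.
Import HBNNSimple.

Let mpre (A : set T2) : measurable A -> measurable (phi @^-1` A).
Proof. by move=> mA; rewrite -[X in measurable X]setTI; exact: mphi. Qed.

(** Splitting the weight over its finitely many values leaves only integrals of [f] over preimages
    under [phi], which is the data compared in [eq_integral_weighted_comp]. *)
Lemma integral_nnsfun_comp (f : T1 -> \bar R) (g : {nnsfun T2 >-> R}) :
  measurable_fun setT f -> (forall x, 0 <= f x) ->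
  \int[m]_x (f x * (g (phi x))%:E) =
  \sum_(r \in range g)
    r%:E * \int[m]_(x in phi @^-1` (g @^-1` [set r])) f x.
Proof.
move=> mf f0.
have mi r : measurable (phi @^-1` (g @^-1` [set r])) by exact: mpre.
transitivity (\int[m]_x \sum_(r \in range g)
    (r%:E * (f x * (\1_(phi @^-1` (g @^-1` [set r])) x)%:E))).
  apply: eq_integral => x _; rewrite fimfunE -fsumEFin//.
  rewrite (@ge0_mule_fsumr _ _ _
    (fun r => (r * \1_(g @^-1` [set r]) (phi x))%:E)).
    by apply: eq_fsbigr => r _; rewrite EFinM muleCA.
  by move=> r; exact: nnfun_muleindic_ge0.
have m1 r : measurable_fun setT
    (fun x => f x * (\1_(phi @^-1` (g @^-1` [set r])) x)%:E).
  by apply: emeasurable_funM => //; exact/measurable_EFinP.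
rewrite ge0_integral_fsum//; last 2 first.
- by move=> r; exact: emeasurable_funM.
- move=> r x _; rewrite muleCA mule_ge0// -EFinM.
  exact: (nnfun_muleindic_ge0 g r (phi x)).
apply: eq_fsbigr => r /[!inE] -[t _ <-].
rewrite ge0_integralZl//; last 2 first.
- by move=> x _; rewrite mule_ge0// lee_fin.
- by rewrite lee_fin.
congr (_ * _); rewrite [RHS]integral_mkcond; apply: eq_integral => x _.
by rewrite patchE indicE; case: ifP; rewrite ?mule1 ?mule0.
Qed.

Let cvg_integral_approx (f : T1 -> \bar R) (W : T2 -> \bar R)
    (mW : measurable_fun setT W) :
  measurable_fun setT f -> (forall x, 0 <= f x) -> (forall x, 0 <= W x) ->
  \int[m]_x (f x * W (phi x)) =
  limn (fun n => \int[m]_x (f x * (nnsfun_approx measurableT mW n (phi x))%:E)).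
Proof.
move=> mf f0 W0; set g := nnsfun_approx measurableT mW.
have nd y : {homo (fun n => (g n y)%:E) : a b / (a <= b)%N >-> a <= b}.
  by move=> a b ab; rewrite lee_fin; exact/lefP/nd_nnsfun_approx.
have cg y : (g n y)%:E @[n --> \oo] --> W y.
  by apply: (cvg_nnsfun_approx measurableT mW) => // z _; exact: W0.
rewrite -monotone_convergence//.
- apply: eq_integral => x _; apply/esym/cvg_lim => //.
  (* Multiplication of extended reals is discontinuous at zero times infinity, so points where [f x]
     or [W (phi x)] vanishes are treated apart. In the latter case the approximations lie between 0
     and their limit 0. *)
  have [->|fx0] := eqVneq (f x) 0.
    by rewrite mul0e; under eq_fun do rewrite mul0e; exact: cvg_cst.
  have [Wx0|Wx0] := eqVneq (W (phi x)) 0; last first.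
    by apply: (cvgeM _ (cvg_cst _) (cg _)); apply: neq0_mule_def;
      rewrite mule_eq0 negb_or fx0.
  rewrite Wx0 mule0 (_ : (fun _ => _) = cst 0); first exact: cvg_cst.
  apply/funext => k; rewrite (_ : (g k (phi x))%:E = 0) ?mule0//.
  apply/eqP; rewrite eq_le [X in _ && X]lee_fin fun_ge0 andbT -[leRHS]Wx0.
  rewrite (cvg_unique (@ereal_hausdorff R) (cg (phi x))
    (ereal_nondecreasing_cvgn (nd (phi x)))).
  by apply: ereal_sup_ubound; exists k.
- move=> k; apply: emeasurable_funM => //; apply/measurable_EFinP.
  exact: measurableT_comp.
- by move=> k x _; rewrite mule_ge0// lee_fin.
- by move=> x _ a b ab; rewrite lee_wpmul2l//; exact: nd.
Qed.

(** By monotone convergence, agreement on events extends from simple weights to all nonnegative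
    ones. With [phi] the identity onto a coarser sigma-algebra, this is the rule that known factors
    may be carried through a conditional expectation. *)
Lemma eq_integral_weighted_comp (f1 f2 : T1 -> \bar R) (W : T2 -> \bar R) :
  measurable_fun setT f1 -> measurable_fun setT f2 ->
  (forall x, 0 <= f1 x) -> (forall x, 0 <= f2 x) ->
  (forall A, measurable A ->
    \int[m]_(x in phi @^-1` A) f1 x = \int[m]_(x in phi @^-1` A) f2 x) ->
  measurable_fun setT W -> (forall x, 0 <= W x) ->
  \int[m]_x (f1 x * W (phi x)) = \int[m]_x (f2 x * W (phi x)).
Proof.
move=> mf1 mf2 f10 f20 f12 mW W0.
rewrite !(cvg_integral_approx mW)//; congr (limn _); apply/funext => n.
by rewrite !integral_nnsfun_comp//; apply: eq_fsbigr => r _; rewrite f12.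
Qed.

End weighted_integral.

(** * Measurability of beta probabilities in the mean *)

Section beta_density_measurable.
Context (R : realType).
Implicit Types (nu : R).

(** Tonelli's theorem, once the domain [D] is absorbed into the integrand as an indicator. *)
Lemma measurable_parametric_integral (d : measure_display)
    (T : measurableType d) (f : T * R -> R) (D : set R) :
  measurable D -> measurable_fun setT f -> (forall z, 0 <= f z) ->
  measurable_fun setT
    (fun x => \int[lebesgue_measure]_(y in D) (f (x, y))%:E)%E.
Proof.
move=> mD mf f0.
have mf' : measurable_fun setT (fun z => (f z * \1_D z.2)%:E).
  apply/measurable_EFinP; apply: measurable_funM => //.
  by apply: (@measurableT_comp _ _ _ _ _ _ (\1_D : R -> R)) => //;
    exact: measurable_indic.
have f'0 z : (0 <= (f z * \1_D z.2)%:E)%E by rewrite lee_fin mulr_ge0.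
have mF := @measurable_fun_fubini_tonelli_F _ _ T (measurableTypeR R) R
  lebesgue_measure _ mf' f'0.
apply: eq_measurable_fun mF => x _.
rewrite /fubini_F [RHS]integral_mkcond; apply: eq_integral => y _.
by rewrite patchE indicE; case: ifP; rewrite ?mulr1 ?mulr0.
Qed.

Lemma measurable_powR2 (d : measure_display) (T : measurableType d)
    (f g : T -> R) : measurable_fun setT f -> measurable_fun setT g ->
  measurable_fun setT (fun x => f x `^ g x).
Proof.
(* A real power is defined by cases: on a zero base it tests whether the exponent is zero, and
   elsewhere it is the exponential of exponent times logarithm. *)
move=> mf mg; apply: measurable_fun_ifT => //.
- exact: measurable_fun_eqr.
- by apply: measurableT_comp => //; exact: measurable_fun_eqr.
- apply: measurableT_comp => //; apply: measurable_funM => //.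
  exact: measurableT_comp.
Qed.

Lemma measurable_Gamma : measurable_fun setT (@Gamma R).
Proof.
apply: measurableT_comp => //=.
apply: (@measurable_parametric_integral _ R
  (fun z => z.2 `^ (z.1 - 1) * expR (- z.2))) => //.
- apply: measurable_funM.
    by apply: measurable_powR2 => //; exact: measurable_funB.
  by apply: measurableT_comp => //; apply: measurable_funN.
- by move=> z; rewrite mulr_ge0// ?powR_ge0// expR_ge0.
Qed.

Lemma Gamma_ge0 (a : R) : 0 <= Gamma a.
Proof.
apply: fine_ge0; apply: integral_ge0 => y _.
by rewrite lee_fin mulr_ge0// ?powR_ge0// expR_ge0.
Qed.

Lemma beta_density_ge0 nu (m y : R) : 0 <= beta_density nu m y.
Proof.
rewrite /beta_density; case: ifP => // _.
by rewrite !mulr_ge0// ?powR_ge0// ?invr_ge0 ?mulr_ge0// Gamma_ge0.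
Qed.

Lemma measurable_beta_prob nu (B : set R) : measurable B ->
  measurable_fun setT
    (fun m => \int[lebesgue_measure]_(y in B) (beta_density nu m y)%:E)%E.
Proof.
move=> mB.
apply: (@measurable_parametric_integral _ R
  (fun z => beta_density nu z.1 z.2)) => //; last first.
  by move=> z; exact: beta_density_ge0.
have mnu : measurable_fun setT (fun z : R * R => nu * z.1).
  exact: measurable_funM.
have mnu' : measurable_fun setT (fun z : R * R => nu * (1 - z.1)).
  by apply: measurable_funM => //; exact: measurable_funB.
have mG (f : R * R -> R) : measurable_fun setT f ->
    measurable_fun setT (fun z => Gamma (f z)).
  by move=> mf; apply: measurableT_comp => //; exact: measurable_Gamma.
apply: measurable_fun_ifT => //.
  apply: (measurable_fun_bool true).
  rewrite setTI (_ : _ @^-1` _ = setT `*` `]0, 1[); first exact: measurableX.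
  by apply/seteqP; split=> [z|z []].
apply: measurable_funM; [apply: measurable_funM|]; last 2 first.
- by apply: measurable_powR2 => //; exact: measurable_funB.
- by apply: measurable_powR2 => //; exact: measurable_funB.
apply: measurable_funM => //.
(* The inverse becomes a power with exponent -1, legitimate since the product of Gamma values is
   nonnegative, so that [measurable_powR2] applies. *)
have -> : (fun z : R * R => (Gamma (nu * z.1) * Gamma (nu * (1 - z.1)))^-1) =
    (fun z => (Gamma (nu * z.1) * Gamma (nu * (1 - z.1))) `^ (- 1)).
  by apply/funext => z; rewrite powR_inv1// mulr_ge0// Gamma_ge0.
by apply: measurable_powR2 => //; apply: measurable_funM; exact: mG.
Qed.

End beta_density_measurable.

(** * Link functions and their Borel inverses *)

Section link.
Context (R : realType).
Implicit Types (f g : R -> R).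

Lemma link_continuous f u : link_function f -> u \in `]0, 1[ ->
  {for u, continuous f}.
Proof.
move=> hf u01; apply: differentiable_continuous; apply/derivable1_diffP.
exact: link_derivable.
Qed.

(** Intervals are the connected subsets of the line, so a continuous image of one is again an
    interval, hence Borel. *)
Lemma measurable_image_interval (D : set R) f :
  is_interval D -> {within D, continuous f} -> measurable (f @` D).
Proof.
move=> iD cf; apply: is_interval_measurable; apply/connected_intervalP.
by apply: connected_continuous_connected => //; apply/connected_intervalP.
Qed.

(** Off the range of [g] on (0, 1) the value is the constant 1/2, which makes the inverse total. *)
Definition link_inverse g (y : R) : R :=
  xget 2^-1 [set u | (u \in `]0, 1[) /\ g u = y].

Lemma link_inverseK g : link_function g ->
  {in `]0, 1[, cancel g (link_inverse g)}.
Proof.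
move=> hg u u01; rewrite /link_inverse.
case: xgetP => [v _ [v01 gv]|/(_ u) []]; last by split.
exact: (link_injective hg).
Qed.

Lemma measurable_link_inverse g : link_function g ->
  measurable_fun setT (link_inverse g).
Proof.
move=> hg; apply: (measurability _ (RGenOInfty.measurableE R)).
move=> _ [_ [r ->] <-]; rewrite setTI.
have mI (I : interval R) : measurable (g @` (`]0, 1[ `&` [set` I])).
  apply: measurable_image_interval.
    move=> a b [a01 aI] [b01 bI] c acb; split.
      exact: (interval_is_interval a01 b01 acb).
    exact: (interval_is_interval aI bI acb).
  apply: continuous_in_subspaceT => u /set_mem[u01 _].
  exact: link_continuous.
(* On the range of [g], the preimage of a ray is the image of an interval. Off the range, it is
   everything or nothing according to whether the default 1/2 exceeds [r]. *)
have -> : link_inverse g @^-1` `]r, +oo[ = (g @` (`]0, 1[ `&` `]r, +oo[)) `|`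
    ((~` (g @` (`]0, 1[ `&` `]-oo, +oo[))) `&` [set _ | r < 2^-1]).
  apply/seteqP; split => y /=; rewrite in_itv/= andbT.
    rewrite /link_inverse; case: xgetP => [v _ [v01 gv] rv|gN rv]; [left|right].
      by exists v => //; split => //=; rewrite in_itv/= andbT.
    by split => // -[u [u01 _] gu]; apply: (gN u).
  case=> [[u [u01 +] <-]|[gN rv]].
    by rewrite link_inverseK//= in_itv/= andbT.
  rewrite /link_inverse; case: xgetP => // v _ [v01 gv].
  by exfalso; apply: gN; exists v.
apply: measurableU => //; apply: measurableI; first exact: measurableC.
by have [_|_] := boolP (r < 2^-1); rewrite ?set_true ?set_false.
Qed.

End link.

(** * The invariant measure along iterates of the map *)

Lemma probability_setI_as (d : measure_display) (T : measurableType d)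
    (R : realType) (P : probability T R) (D A : set T) :
  measurable D -> measurable A -> P D = 1%E -> P (D `&` A) = P A.
Proof.
move=> mD mA PD; have AD0 : P (A `\` D) = 0%E.
  apply: (subset_measure0 _ (measurableC mD)) => //; first exact: measurableD.
  by rewrite [LHS]probability_setC// PD subee.
by rewrite setIC [RHS](measureDI P mA mD) [X in _ = (X + _)%E]AD0 add0e.
Qed.

Section acim.
Context (R : realType) (T : R -> R) (lam : probability (measurableTypeR R) R).
Hypotheses (hT : interval_map T) (hlam : is_acim T lam).

(* T extended by 0 outside [0, 1], so as to be measurable on R *)
Definition interval_map_ext : R -> R := T \_ `[0, 1].

Lemma measurable_interval_map_ext : measurable_fun setT interval_map_ext.
Proof. by apply/(measurable_restrictT _ _).1 => //; case: hT. Qed.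

Lemma measurable_iter_ext (k : nat) :
  measurable_fun setT (iter k interval_map_ext).
Proof.
elim: k => [|k IH]; first exact: measurable_id.
exact: (measurableT_comp measurable_interval_map_ext IH).
Qed.

Lemma iter_ext (k : nat) (u : R) : u \in `[0, 1] ->
  iter k interval_map_ext u = iter k T u /\ iter k T u \in `[0, 1].
Proof.
move=> u01; elim: k => [//|k [IH1 IH2]] /=; rewrite IH1; split.
  by rewrite /interval_map_ext patchE mem_set.
by case: hT => _; exact.
Qed.

Lemma lam_unit_interval (A : set (measurableTypeR R)) : measurable A ->
  lam ([set` `[0, 1]] `&` A) = lam A.
Proof.
have m01 : @measurable _ (measurableTypeR R) `[0, 1]%classic.
  exact: measurable_itv.
move=> mA; exact (probability_setI_as m01 mA (acim_support hlam)).
Qed.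

(** Invariance is only given for subsets of [0, 1]. Since [lam] is concentrated there, both sides
    may be intersected with [0, 1], where the extension agrees with [T]. *)
Lemma lam_interval_map_ext (A : set (measurableTypeR R)) : measurable A ->
  lam (interval_map_ext @^-1` A) = lam A.
Proof.
move=> mA; have mTA : @measurable _ (measurableTypeR R)
    (interval_map_ext @^-1` A).
  by rewrite -[X in measurable X]setTI; exact: measurable_interval_map_ext.
rewrite -(lam_unit_interval mTA) -(lam_unit_interval mA).
have mA01 : @measurable _ (measurableTypeR R) ([set` `[0, 1]] `&` A).
  by apply: measurableI => //; exact: measurable_itv.
rewrite -(acim_invariant hlam mA01); last by move=> ? [].
congr (lam _); apply/seteqP; split=> u [u01] /=.
  rewrite /interval_map_ext patchE mem_set// => Au.
  by do !split => //; case: hT => _ /(_ _ u01).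
by case=> _ Au; split => //; rewrite /interval_map_ext patchE mem_set.
Qed.

Lemma lam_iter_ext (k : nat) (A : set (measurableTypeR R)) : measurable A ->
  lam (iter k interval_map_ext @^-1` A) = lam A.
Proof.
move=> mA; elim: k => [//|k IH]; rewrite -[RHS]IH.
rewrite -[in RHS]lam_interval_map_ext.
  by congr (lam _); apply/seteqP; split=> u /=; rewrite -iterSr.
by rewrite -[X in measurable X]setTI; exact: measurable_iter_ext.
Qed.

(** Absolute continuity excludes atoms, so the endpoints 0 and 1 are null. Together with invariance,
    this keeps orbits almost surely inside the domain of [h]. *)
Lemma lam_open_unit_interval : lam (~` `]0, 1[) = 0%E.
Proof.
have m1 (a : R) : @measurable _ (measurableTypeR R) [set a].
  exact: measurable_set1.
have l1 (a : R) : lam [set a] = 0%E.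
  apply: (acim_abs_continuous hlam (t := [set a]) _ (m1 a)) => // N mN Na.
  exact: (subset_measure0 mN (m1 a) Na (lebesgue_measure_set1 a)).
have mI : @measurable _ (measurableTypeR R) (~` `]0, 1[).
  by apply: measurableC; exact: measurable_itv.
rewrite -(lam_unit_interval mI).
apply: (subset_measure0 _ (measurableU _ _ (m1 0) (m1 1))) => //.
- by apply: measurableI => //; exact: measurable_itv.
- move=> u [] /=; rewrite !in_itv/= => /andP[u0 u1].
  move/negP; rewrite !lt_neqAle u0 u1 !andbT negb_and !negbK.
  by move=> /orP[/eqP<-|/eqP->]; [left|right].
- exact: (null_set_setU (m1 0) (m1 1) (l1 0) (l1 1)).
Qed.

End acim.

(** * Conditioning on the past and the product formula for responses *)

Lemma measurable_fun_sigma_sub (T : pointedType) (d : measure_display)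
    (V : measurableType d) (G1 G2 : set (set T)) (f : T -> V) :
  G1 `<=` <<s G2 >> ->
  measurable_fun [set: g_sigma_algebraType G1] f ->
  measurable_fun [set: g_sigma_algebraType G2] f.
Proof.
move=> G12 mf _ B mB; have := mf measurableT B mB; rewrite !setTI.
by apply: smallest_sub => //; exact: smallest_sigma_algebra.
Qed.

Section conditional_product.
Context (d d' : measure_display) (Omega : measurableType d)
  (S : measurableType d') (R : realType) (P : probability Omega R)
  (U0 : {RV P >-> R}) (x : nat -> {RV P >-> S}) (Y : nat -> {RV P >-> R}).
Hypothesis exo : exogenous U0 x Y.

(** Generators of the randomness that excludes the responses: the initial state and the whole
    covariate path. *)
Definition driving_sets : set (set Omega) :=
  g_sigma_algebra_preimage U0 `|` covariate_sigma x.

(** Generators of the enlarged conditioning sigma-algebra in [exogenous_response], where all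
    covariates, including future ones, are known at time [t]. *)
Definition past_sets (t : nat) : set (set Omega) :=
  information U0 x Y t `|` covariate_sigma x.

Let preimage_sub (d1 : measure_display) (V : measurableType d1)
  (f : {mfun Omega >-> V}) : g_sigma_algebra_preimage f `<=` measurable.
Proof. by move=> _ [B mB <-]; exact: measurable_funP. Qed.

Lemma past_measurable (t : nat) : <<s past_sets t >> `<=` measurable.
Proof.
apply: smallest_sub; first exact: sigma_algebra_measurable.
move=> A [|]; apply: smallest_sub A; try exact: sigma_algebra_measurable.
- move=> A [|]; last exact: preimage_sub.
  apply: smallest_sub A; first exact: sigma_algebra_measurable.
  by move=> A [|[s _ [|]]]; exact: preimage_sub.
- by move=> A [s _]; exact: preimage_sub.
Qed.

Lemma initial_history (t : nat) :
  g_sigma_algebra_preimage U0 `<=` history U0 x Y t.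
Proof. by move=> A ?; apply: sub_sigma_algebra; left. Qed.

Lemma history_information (t : nat) :
  history U0 x Y t.-1 `<=` information U0 x Y t.
Proof. by move=> A ?; apply: sub_sigma_algebra; left. Qed.

Lemma driving_past (t : nat) : driving_sets `<=` <<s past_sets t >>.
Proof.
move=> A [A0|Ax]; apply: sub_sigma_algebra.
  by left; apply: history_information; exact: initial_history.
by right.
Qed.

Lemma response_past (s t : nat) (B : set R) : measurable B ->
  (1 <= s < t)%N -> <<s past_sets t >> (Y s @^-1` B).
Proof.
move=> mB st; apply: sub_sigma_algebra; left; apply: history_information.
apply: sub_sigma_algebra; right; exists s => /=.
  by case: t st => [|t] /=; rewrite ?ltnS// ltn0 andbF.
by right; exists B => //; rewrite setTI.
Qed.

(** Exogeneity makes [Z] a conditional probability given the whole covariate path as well, so the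
    weight [W] may depend on future covariates. *)
Lemma integral_cond_prob (t : nat) (B : set R) (Z W : Omega -> \bar R) :
  (1 <= t)%N -> measurable B -> (forall w, 0 <= Z w)%E ->
  is_cond_prob P (information U0 x Y t) (Y t @^-1` B) Z ->
  measurable_fun [set: g_sigma_algebraType (past_sets t)] W ->
  (forall w, 0 <= W w)%E ->
  (\int[P]_w ((\1_(Y t @^-1` B) w)%:E * W w) = \int[P]_w (Z w * W w))%E.
Proof.
move=> t1 mB Z0 /(exogenous_response exo t1 mB) [mZ _ EZ] mW W0.
have mYB : measurable (Y t @^-1` B).
  by rewrite -[X in measurable X]setTI; exact: measurable_funP.
(* The map is the identity, its target carrying the coarser sigma-algebra of the past, so preimages
   of measurable sets are exactly the conditioning events. *)
apply: (@eq_integral_weighted_comp _ _ Omega (g_sigma_algebraType (past_sets t))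
  R P idfun) => //.
- by move=> _ A mA; rewrite setTI; exact: (past_measurable mA).
- exact/measurable_EFinP/measurable_indic.
- by move=> _ A mA; rewrite setTI; apply: (past_measurable (t := t)); exact: mZ.
- by move=> A mA; rewrite -EZ.
Qed.

Variables (k : nat) (B : nat -> set R) (Z q : nat -> Omega -> \bar R).
Hypotheses (mB : forall i, measurable (B i)) (Z0 : forall i w, (0 <= Z i w)%E)
  (hZ : forall i, is_cond_prob P (information U0 x Y (k + i).+1)
    (Y (k + i).+1 @^-1` B i) (Z i))
  (q0 : forall i w, (0 <= q i w)%E)
  (mq : forall i, measurable_fun [set: g_sigma_algebraType driving_sets] (q i))
  (Zq : forall i, {ae P, forall w, Z i w = q i w}).

Definition response_event (n : nat) : set Omega :=
  [set w | forall i, (i < n)%N -> B i (Y (k + i).+1 w)].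

Lemma response_eventS (n : nat) : response_event n.+1 =
  Y (k + n).+1 @^-1` B n `&` response_event n.
Proof.
apply/seteqP; split=> w; rewrite /response_event/=.
  by move=> h; split=> [|i ni]; apply: h => //; exact: ltnW.
case=> hn h i; rewrite ltnS leq_eqVlt => /orP[/eqP->//|]; exact: h.
Qed.

Lemma response_event_past (n t : nat) : (k + n < t)%N ->
  <<s past_sets t >> (response_event n).
Proof.
elim: n => [|n IH] nt.
  rewrite (_ : response_event 0 = setT); last by apply/seteqP; split.
  exact: (@measurableT _ (g_sigma_algebraType (past_sets t))).
rewrite response_eventS.
apply: (@measurableI _ (g_sigma_algebraType (past_sets t))).
  by apply: response_past => //=; rewrite -addnS.
by apply: IH; apply: ltn_trans nt; rewrite addnS.
Qed.

Let mdriving (W : Omega -> \bar R) t :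
  measurable_fun [set: g_sigma_algebraType driving_sets] W ->
  measurable_fun [set: g_sigma_algebraType (past_sets t)] W.
Proof. by apply: measurable_fun_sigma_sub; exact: driving_past. Qed.

Let mOmega (W : Omega -> \bar R) t :
  measurable_fun [set: g_sigma_algebraType (past_sets t)] W ->
  measurable_fun [set: Omega] W.
Proof.
move=> mW _ A mA; rewrite setTI; apply: (past_measurable (t := t)).
by rewrite -[X in smallest _ _ X]setTI; exact: mW.
Qed.

(** Backward tower property, by induction with [W] general: the last response is integrated out, its
    probability is replaced by the version [q n], and [q n] joins the weight for the remaining
    responses. *)
Lemma integral_response_event (n : nat) (W : Omega -> \bar R) :
  measurable_fun [set: g_sigma_algebraType driving_sets] W ->
  (forall w, 0 <= W w)%E ->
  (\int[P]_w ((\1_(response_event n) w)%:E * W w) =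
   \int[P]_w ((\prod_(i < n) q i w) * W w))%E.
Proof.
elim: n W => [|n IH] W mW W0.
  apply: eq_integral => w _; rewrite big_ord0 indicE mem_set//.
have mD : measurable_fun
    [set: g_sigma_algebraType (past_sets (k + n).+1)]
    (fun w => (\1_(response_event n) w)%:E : \bar R).
  by apply/measurable_EFinP/measurable_indic; exact: response_event_past.
have mDW : measurable_fun
    [set: g_sigma_algebraType (past_sets (k + n).+1)]
    (fun w => (\1_(response_event n) w)%:E * W w)%E.
  by apply: emeasurable_funM => //; exact: mdriving.
have DW0 w : (0 <= (\1_(response_event n) w)%:E * W w)%E.
  by rewrite mule_ge0// lee_fin.
(* The last response is isolated; the earlier ones and [W] form a weight known at time
   [(k + n).+1]. *)
transitivity (\int[P]_w ((\1_(Y (k + n).+1 @^-1` B n) w)%:E *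
    ((\1_(response_event n) w)%:E * W w)))%E.
  apply: eq_integral => w _; rewrite muleA -EFinM.
  by rewrite response_eventS indicI.
rewrite (integral_cond_prob _ (mB n) (@Z0 n))//.
have [mZ _ _] := exogenous_response exo (ltn0Sn _) (mB n) (hZ n).
(* [Z n] may depend on earlier responses, whereas the induction hypothesis requires a weight driven
   by [U0] and [x] alone; hence the passage to [q n]. *)
transitivity (\int[P]_w ((\1_(response_event n) w)%:E * (q n w * W w)))%E.
  apply: ge0_ae_eq_integral => //.
  - apply: emeasurable_funM; last exact: mOmega mDW.
    by move=> _ A mA; rewrite setTI; apply: (past_measurable (t := (k + n).+1));
      exact: mZ.
  - apply: emeasurable_funM; first exact: mOmega mD.
    by apply: (@mOmega _ 0); apply: mdriving; exact: emeasurable_funM.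
  - by move=> w _; rewrite mule_ge0.
  - by move=> w _; rewrite !mule_ge0// lee_fin.
  - by apply: filterS (Zq n) => w Zqw _; rewrite Zqw muleCA.
rewrite IH; last 2 first.
- exact: emeasurable_funM.
- by move=> w; rewrite mule_ge0.
by apply: eq_integral => w _; rewrite big_ord_recr/= muleA.
Qed.

End conditional_product.

(** * Laws of tuples are determined by boxes *)

Section tuple_law.
Context (d : measure_display) (S : measurableType d) (n : nat).

Definition tuple_box (B : 'I_n -> set S) : set (n.-tuple S) :=
  [set v | forall i, B i (tnth v i)].

Lemma measurable_tuple_box (B : 'I_n -> set S) :
  (forall i, measurable (B i)) -> measurable (tuple_box B).
Proof.
move=> mB; rewrite (_ : tuple_box B =
  \bigcap_(i in [set: 'I_n]) (@tnth n S ^~ i @^-1` B i)).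
  apply: fin_bigcap_measurable; first exact: finite_finset.
  by move=> i _; rewrite -[X in measurable X]setTI; exact: measurable_tnth.
by apply/seteqP; split=> v h i => [_|]; exact: h.
Qed.

(** The sigma-algebra of tuples is generated by preimages under coordinates, and each of these is a
    box with all other sides full. *)
Lemma measurable_tuple_boxE :
  @measurable _ (n.-tuple S) =
  <<s [set tuple_box B | B in [set B | forall i, measurable (B i)]] >>.
Proof.
apply/seteqP; split.
  apply: smallest_sub; first exact: smallest_sigma_algebra.
  move=> C; rewrite -bigcup_seq => -[i _ [B mB <-]]; apply: sub_sigma_algebra.
  exists (fun j => if j == i then B else setT).
    by move=> j /=; case: ifP.
  apply/seteqP; split=> v /=.
    by move=> /(_ i); rewrite eqxx.
  by move=> [_ Bv] j; case: eqP => // ->.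
apply: smallest_sub; first exact: sigma_algebra_measurable.
by move=> _ [B mB <-]; exact: measurable_tuple_box.
Qed.

(** Boxes are stable under intersection, generate the sigma-algebra and include the whole space, so
    uniqueness of finite measures on a pi-system applies. *)
Lemma tuple_measure_unique (R : realType)
    (m1 m2 : {measure set (n.-tuple S) -> \bar R}) :
  (m1 setT < +oo)%E ->
  (forall B, (forall i, measurable (B i)) ->
    m1 (tuple_box B) = m2 (tuple_box B)) ->
  forall A, measurable A -> m1 A = m2 A.
Proof.
move=> m1fin m12 A mA.
apply: (measure_unique
  [set tuple_box B | B in [set B | forall i, measurable (B i)]]
  (fun=> setT)) => //.
- exact: measurable_tuple_boxE.
- move=> _ _ [B mB <-] [B' mB' <-]; exists (fun i => B i `&` B' i).
    by move=> i; exact: measurableI.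
  apply/seteqP; split=> v /=.
    by move=> h; split=> i; case: (h i).
  by case=> h h' i; split.
- by move=> _; exists (fun=> setT) => //; apply/seteqP; split.
- by apply/seteqP; split=> // v _; exists 0%N.
- by move=> _ [B mB <-]; exact: m12.
Qed.

End tuple_law.

(** * Shift invariance of the joint law of covariates and state *)

Section shift.
Context (d d' : measure_display) (Omega : measurableType d)
  (S : measurableType d') (R : realType) (P : probability Omega R)
  (U0 : {RV P >-> R}) (x : nat -> {RV P >-> S}) (F : R -> R).
Hypotheses (mF : measurable_fun setT F)
  (invF : forall A : set R, measurable A ->
    P (U0 @^-1` (F @^-1` A)) = P (U0 @^-1` A))
  (indep : forall (B : set R) (C : set Omega),
    measurable B -> covariate_sigma x C ->
    P (U0 @^-1` B `&` C) = (P (U0 @^-1` B) * P C)%E)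
  (hx : stationary x).
Variable n : nat.

(** The order of the sum matches [t i + k] in [stationary], with [t i] taken to be [i.+1]. *)
Definition covariate_block (k : nat) (w : Omega) : n.-tuple S :=
  [tuple x (i.+1 + k)%N w | i < n].

Lemma covariate_block_sigma (k : nat) (A : set (n.-tuple S)) : measurable A ->
  covariate_sigma x (covariate_block k @^-1` A).
Proof.
pose G := \bigcup_(s in [set s | (1 <= s)%N]) g_sigma_algebra_preimage (x s).
suff : measurable_fun [set: g_sigma_algebraType G] (covariate_block k).
  by move=> mX mA; have := mX measurableT A mA; rewrite setTI.
apply/measurable_fun_tnthP => i _ B mB; rewrite setTI.
apply: sub_sigma_algebra.
exists (i.+1 + k)%N; first by rewrite /= addSn.
by exists B => //; apply/seteqP; split=> w /=; rewrite tnth_mktuple;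
  [case|split].
Qed.

Lemma covariate_sigma_measurable : covariate_sigma x `<=` measurable.
Proof.
apply: smallest_sub; first exact: sigma_algebra_measurable.
by move=> _ [s _ [B mB <-]]; exact: measurable_funP.
Qed.

Lemma measurable_covariate_block (k : nat) :
  measurable_fun setT (covariate_block k).
Proof.
move=> _ A mA; rewrite setTI; apply: covariate_sigma_measurable.
exact: covariate_block_sigma.
Qed.

(** Both sides are integrals against one product law: stationarity fixes the factor of the
    covariates, and [invF] that of the state. *)
Lemma integral_covariate_block (k : nat) (Phi : n.-tuple S * R -> \bar R) :
  measurable_fun setT Phi -> (forall z, 0 <= Phi z)%E ->
  (\int[P]_w Phi (covariate_block k w, F (U0 w)) =
   \int[P]_w Phi (covariate_block 0 w, U0 w))%E.
Proof.
move=> mPhi Phi0.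
have mU0 : measurable_fun setT U0 by exact: measurable_funP.
have mX j := measurable_covariate_block j.
pose X0 : {mfun Omega >-> n.-tuple S} :=
  HB.pack (covariate_block 0) (isMeasurableFun.Build _ _ _ _ _ (mX 0%N)).
(* Stated for any state [V] that is independent of the covariates and distributed as [U0], so as to
   serve both [F \o U0] and [U0]. *)
have law (j : nat) (V : Omega -> R) (mV : measurable_fun setT V) :
    (forall (B : set R) C, measurable B -> covariate_sigma x C ->
      P (V @^-1` B `&` C) = (P (U0 @^-1` B) * P C)%E) ->
    (\int[P]_w Phi (covariate_block j w, V w) =
     \int[distribution P X0 \x distribution P U0]_z Phi z)%E.
  move=> hV.
  have mXV : measurable_fun setT (fun w => (covariate_block j w, V w)).
    exact: measurable_fun_pair.
  pose XV : {mfun Omega >-> (n.-tuple S * R)%type} :=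
    HB.pack (fun w => (covariate_block j w, V w))
      (isMeasurableFun.Build _ _ _ _ _ mXV).
  transitivity (\int[distribution P XV]_z Phi z)%E.
    by rewrite /distribution ge0_integral_pushforward.
  apply: eq_measure_integral => A mA _; apply/esym.
  (* A product measure is determined by its values on rectangles. *)
  apply: product_measure_unique => // C D mC mD.
  have XVE : XV @^-1` (C `*` D) = V @^-1` D `&` covariate_block j @^-1` C.
    by rewrite setIC.
  have XE : P (covariate_block j @^-1` C) = P (covariate_block 0 @^-1` C).
    have := @hx n (fun i => i.+1) j C (fun=> isT) mC.
    rewrite /covariate_block /preimage/= => ->; congr (P _).
    by apply/seteqP; split=> w /=; congr (C _); apply: eq_mktuple => i;
      rewrite addn0.
  rewrite [LHS](congr1 P XVE) hV//; last exact: covariate_block_sigma.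
  by rewrite muleC XE.
rewrite (law k (F \o U0)) ?(law 0%N U0)//.
- exact: measurableT_comp.
- move=> B C mB xC; rewrite comp_preimage indep// ?invF//.
  by rewrite -[X in measurable X]setTI; exact: mF.
Qed.

End shift.

(** * Reduction of stationarity to consecutive times *)

(** Arbitrary times, unordered and possibly repeated, are embedded in a window of consecutive times;
    boxes suffice because they determine the law of a tuple. *)
Lemma stationary_boxP (d d' : measure_display) (Omega : measurableType d)
    (S : measurableType d') (R : realType) (P : probability Omega R)
    (X : nat -> {RV P >-> S}) :
  (forall (n k : nat) (B : nat -> set S), (forall i, measurable (B i)) ->
    P [set w | forall i, (i < n)%N -> B i (X (k + i).+1 w)] =
    P [set w | forall i, (i < n)%N -> B i (X i.+1 w)]) ->
  stationary X.
Proof.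
move=> hX n t k A t1 mA.
have mXt j : measurable_fun setT (fun w => [tuple X (t i + j)%N w | i < n]).
  apply/measurable_fun_tnthP => i.
  rewrite (_ : _ \o _ = X (t i + j)%N); first exact: measurable_funP.
  by apply/funext => w /=; rewrite tnth_mktuple.
pose Xt j : {mfun Omega >-> n.-tuple S} :=
  HB.pack (fun w => [tuple X (t i + j)%N w | i < n])
    (isMeasurableFun.Build _ _ _ _ _ (mXt j)).
suff h : distribution P (Xt k) A = distribution P (Xt 0%N) A.
  move: h; rewrite /distribution /pushforward /preimage/= => ->.
  congr (P _); apply/seteqP; split=> w /=; congr (A _); apply: eq_mktuple => i;
  by rewrite addn0.
apply: tuple_measure_unique mA.
  by rewrite [ltLHS]probability_setT ltry.
move=> B mB.
(* Every [t i] is at most the sum [N], so the window 1, ..., [N] contains all sampled times. *)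
pose N := (\sum_(i < n) t i)%N.
(* Index [j] stands for time [j.+1]. Repeated times intersect their constraints, and a time that is
   not sampled gets the empty intersection, that is, no constraint. *)
pose B' (j : nat) := \bigcap_(i in [set i | t i = j.+1]) B i.
have mB' j : measurable (B' j).
  apply: fin_bigcap_measurable; last by move=> i _; exact: mB.
  exact: finite_finset.
have boxE j : Xt j @^-1` tuple_box B =
    [set w | forall i, (i < N)%N -> B' i (X (j + i).+1 w)].
  apply/seteqP; split=> w /=.
    move=> h i _ i' /= ti'; have := h i'; rewrite tnth_mktuple ti'.
    by rewrite addSn addnC.
  move=> h i; rewrite tnth_mktuple.
  have tN : ((t i).-1 < N)%N by rewrite prednK// /N (bigD1 i)//= leq_addr.
  have := h _ tN i; rewrite /= prednK// -addnS prednK// addnC; exact.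
transitivity (P (Xt k @^-1` tuple_box B)) => //.
transitivity (P (Xt 0%N @^-1` tuple_box B)) => //.
by rewrite !boxE hX.
Qed.

(** * Joint probabilities of the responses as integrals over covariates and state *)

Lemma emeasurable_prod (d : measure_display) (T : measurableType d)
    (R : realType) (I : Type) (s : seq I) (D : set T) (f : I -> T -> \bar R) :
  (forall i, measurable_fun D (f i)) ->
  measurable_fun D (fun w => \prod_(i <- s) f i w)%E.
Proof.
move=> mf; elim: s => [|i s IH].
  by under eq_fun do rewrite big_nil; exact: measurable_cst.
by under eq_fun do rewrite big_cons; exact: emeasurable_funM.
Qed.

Unset Implicit Arguments.
Set Strict Implicit.

Theorem corollary2p3 (R : realType) (d : measure_display)
    (Omega : measurableType d) (P : probability Omega R)
    (r l : nat) (T : 'rV[R]_r -> R -> R) (theta : 'rV[R]_r)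
    (lam : probability (measurableTypeR R) R)
    (U0 : {RV P >-> R}) (x : nat -> {RV P >-> l.-tuple R})
    (Y : nat -> {RV P >-> R}) (mu : nat -> Omega -> R)
    (nu alpha : R) (beta : l.-tuple R) (g h : R -> R)
    (hT : interval_map (T theta))
    (hlam : is_acim (T theta) lam)
    (hnu : 0 < nu)
    (hg : link_function g)
    (hh : link_function h)
    (hY : betaARC (T theta) U0 x Y mu nu g h alpha beta)
    (hU0 : forall A : set (measurableTypeR R),
       measurable A -> distribution P U0 A = lam A)
    (hx : stationary x) :
  stationary Y.
Proof.
pose F := interval_map_ext (T theta).
have mF k : measurable_fun setT (iter k F) by exact: measurable_iter_ext.
have lawU0 (k : nat) (A : set R) : measurable A ->
    P (U0 @^-1` (iter k F @^-1` A)) = lam A.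
  move=> mA; rewrite -(lam_iter_ext hT hlam k mA) -hU0//.
  by rewrite -[X in measurable X]setTI; exact: mF.
have U01 w : U0 w \in `[0, 1].
  by apply: subset_itv_oo_cc; exact: betaARC_initial hY w.
have iterF k w : iter k F (U0 w) = iter k (T theta) (U0 w).
  by have [] := iter_ext hT k (U01 w).
(* Extending [h] by 0 off (0, 1) gives a function that is Borel on the whole line. *)
pose h0 : R -> R := h \_ `]0, 1[.
have mh0 : measurable_fun setT h0.
  apply/(measurable_restrictT _ _).1 => //.
  apply: open_continuous_measurable_fun; first exact: itv_open.
  by move=> u; rewrite inE => u01; exact: link_continuous.
apply: stationary_boxP => n k B mB.
(* The probability of [B i] under the beta law whose mean solves the link equation, given the
   covariate [z.1] and a state [z.2] that lies [i] iterations earlier. *)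
pose Q i (z : l.-tuple R * R) := (\int[lebesgue_measure]_(y in B i)
  (beta_density nu (link_inverse g (alpha
    + \sum_(j < l) tnth z.1 j * tnth beta j + h0 (iter i F z.2))%R) y)%:E)%E.
have Q0 i z : (0 <= Q i z)%E.
  by apply: integral_ge0 => y _; rewrite lee_fin beta_density_ge0.
have mQ i : measurable_fun setT (Q i).
  pose eta (z : l.-tuple R * R) :=
    alpha + \sum_(j < l) tnth z.1 j * tnth beta j + h0 (iter i F z.2).
  apply: (measurableT_comp (measurable_beta_prob nu (mB i))
    (g := link_inverse g \o eta)).
  apply: measurableT_comp; first exact: measurable_link_inverse.
  apply: measurable_funD; last first.
    apply: measurableT_comp => //; apply: measurableT_comp => //; exact: mF.
  apply: measurable_funD => //.
  apply: measurable_sum => j; apply: measurable_funM => //.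
  apply: (@measurableT_comp _ _ _ _ _ _ (@tnth l R ^~ j)) => //.
  exact: measurable_tnth.
pose Phi (z : n.-tuple (l.-tuple R) * R) : \bar R :=
  (\prod_(i < n) Q i (tnth z.1 i, z.2))%E.
have Phi0 z : (0 <= Phi z)%E by apply: prode_ge0 => i _.
have mPhi : measurable_fun setT Phi.
  apply: emeasurable_prod => i; apply: measurableT_comp => //.
  apply: measurable_fun_pair => //.
  by apply: (@measurableT_comp _ _ _ _ _ _ (@tnth n _ ^~ i)) => //;
    exact: measurable_tnth.
(* The shift enters only through the block and the iterated state, so shifts [k] and 0 can be
   compared by [integral_covariate_block]. *)
suff main j : P (response_event Y j B n) =
    (\int[P]_w Phi (covariate_block x n j w, iter j F (U0 w)))%E.
  have -> : [set w | forall i, (i < n)%N -> B i (Y (k + i).+1 w)] =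
    response_event Y k B n by [].
  have -> : [set w | forall i, (i < n)%N -> B i (Y i.+1 w)] =
    response_event Y 0 B n by [].
  rewrite !main; apply: (integral_covariate_block (mF k)) => //.
  - by move=> A mA; rewrite (lawU0 k)// -(lawU0 0%N).
  - exact: exogenous_initial (betaARC_exogenous hY).
pose Z i w := (\int[lebesgue_measure]_(y in B i)
  (beta_density nu (mu (j + i).+1 w) y)%:E)%E.
pose q i w := Q i (x (j + i).+1 w, iter j F (U0 w)).
have Zq i : {ae P, forall w, Z i w = q i w}.
  have V01 : {ae P, forall w, iter (j + i) (T theta) (U0 w) \in `]0, 1[}.
    (* The exceptional event is that the orbit lies outside (0, 1) at this iterate; by invariance
       its probability is the [lam]-mass of the complement of (0, 1), which is zero. *)
    exists (U0 @^-1` (iter (j + i) F @^-1` (~` `]0, 1[))); split.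
    - rewrite -[X in measurable X]setTI; apply: measurable_funP => //.
      rewrite -[X in measurable X]setTI; apply: mF => //.
      exact/measurableC.
    - by rewrite lawU0 ?(lam_open_unit_interval hlam)//; exact/measurableC.
    - by move=> w /=; rewrite iterF.
  (* Time [(j + i).+1] corresponds to iterate [j + i], reached from the state at [j] by [i] further
     steps. *)
  apply: filterS2 (betaARC_link hY (ltn0Sn (j + i))) V01 => w /= gmu {}V01.
  have jiE : iter i F (iter j F (U0 w)) = iter (j + i) (T theta) (U0 w).
    by rewrite -iterD addnC iterF.
  have h0E : h0 (iter i F (iter j F (U0 w))) =
      h (iter (j + i) (T theta) (U0 w)).
    by rewrite jiE /h0 patchE mem_set.
  by rewrite /Z /q /Q h0E -gmu link_inverseK//; exact: (betaARC_mu01 hY).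
have mq i : measurable_fun
    [set: g_sigma_algebraType (driving_sets U0 x)] (q i).
  apply: measurableT_comp => //; apply: measurable_fun_pair.
    move=> _ A mA; rewrite setTI; apply: sub_sigma_algebra; right.
    apply: sub_sigma_algebra; exists (j + i).+1 => //.
    by exists A => //; rewrite setTI.
  apply: measurableT_comp; first exact: mF.
  move=> _ A mA; rewrite setTI; apply: sub_sigma_algebra; left.
  by exists A => //; rewrite setTI.
have mev : measurable (response_event Y j B n).
  by apply: (@past_measurable _ _ _ _ _ _ U0 x Y (j + n).+1);
    exact: response_event_past.
rewrite -(setIT (response_event _ _ _ _)) -integral_indic//.
(* The product formula is applied with the constant weight 1. *)
transitivity (\int[P]_w ((\1_(response_event Y j B n) w)%:E * 1))%E.
  by under [RHS]eq_integral do rewrite mule1.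
rewrite (integral_response_event (betaARC_exogenous hY) (Z := Z) (q := q))//.
- apply: eq_integral => w _; rewrite mule1; apply: eq_bigr => i _.
  by rewrite /q /= tnth_mktuple addSn addnC.
- by move=> i w; apply: integral_ge0 => y _; rewrite lee_fin beta_density_ge0.
- by move=> i; exact: (betaARC_density hY).
- by move=> i w; exact: Q0.
Qed.
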